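(* Let $G = (V(G), E(G), \mathbf{s}, \mathbf{r})$ be a non-trivial directed graph. The induced subgraph of $\Gamma(I(G))$ with vertex set $\mathrm{Path}(G) \cup \mathrm{Path}(G)^{-1}$ is a complete subgraph of $\Gamma(I(G))$.
   Context: A directed graph $G=(V(G),E(G),\mathbf{s},\mathbf{r})$ has a non-empty vertex set $V(G)$, an edge set $E(G)$ (loops and multiple edges allowed), and source and range maps $\mathbf{s},\mathbf{r}:E(G)\to V(G)$. It is trivial if it consists of one isolated vertex (one vertex, no edges); non-trivial otherwise. $\mathrm{Path}(G)$ is the set of all finite directed paths $p=e_1\cdots e_n$ (with $\mathbf{r}(e_i)=\mathbf{s}(e_{i+1})$, $\mathbf{s}(p)=\mathbf{s}(e_1)$, $\mathbf{r}(p)=\mathbf{r}(e_n)$), including each vertex $v$ as an empty path with $\mathbf{s}(v)=\mathbf{r}(v)=v$. $\mathrm{Path}(G)^{-1}=\{p^{-1}:p\in\mathrm{Path}(G)\}$, where $p^{-1}=e_n^{-1}\cdots e_1^{-1}$ and $v^{-1}=v$. The graph inverse semigroup $I(G)$ is the semigroup with zero generated by $V(G)\cup E(G)\cup\{e^{-1}:e\in E(G)\}$ subject to, for $u,v\in V(G)$, $e,f\in E(G)$: $uv=\delta_{u,v}u$; $\mathbf{s}(e)e=e\mathbf{r}(e)=e$; $\mathbf{r}(e)e^{-1}=e^{-1}\mathbf{s}(e)=e^{-1}$; $e^{-1}f=\delta_{e,f}\mathbf{r}(e)$. Every non-zero element is uniquely $pq^{-1}$ with $p,q\in\mathrm{Path}(G)$,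 $\mathbf{r}(p)=\mathbf{r}(q)$; $(pq^{-1})(rs^{-1})$ equals $pts^{-1}$ if $r=qt$, $p(st)^{-1}$ if $q=rt$ (for a possibly empty path $t$), and $0$ otherwise. $I(G)$ is an inverse semigroup with idempotents $pp^{-1}$ ($p\in\mathrm{Path}(G)$) and $0$. For an inverse semigroup $T$ with zero, the natural partial order is $a\le b$ iff $a=eb$ for some idempotent $e$; $\omega(a,b)=\{c\in T:c\le a \text{ and } c\le b\}$. The zero-divisor graph $\Gamma(T)$ is the simple undirected graph with vertex set $Z(T)^\times=\{a\in T\setminus\{0\}:\exists\,b\in T\setminus\{0\},\ \omega(a,b)=\{0\}\}$, where distinct vertices $a,b$ are adjacent iff $\omega(a,b)=\{0\}$. A graph is complete if every pair of distinct vertices is adjacent. *)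

(* Defs.v *)
From HB Require Import structures.
From mathcomp Require Import all_boot boolp classical_sets.

Set Implicit Arguments.
Unset Strict Implicit.
Unset Printing Implicit Defensive.

Local Open Scope classical_set_scope.
Local Open Scope group_scope.

Record digraph := Digraph {
  vertex : Type;
  edge : Type;
  src : edge -> vertex;
  rng : edge -> vertex;
  vertex_inhabited : inhabited vertex }.

Definition trivial_digraph (G : digraph) : Prop :=
  (exists v : vertex G, forall u : vertex G, u = v) /\ (edge G -> False).

Definition nontrivial_digraph (G : digraph) : Prop := ~ trivial_digraph G.

HB.mixin Record Semigroup_hasZero T of Semigroup T := {
  szero : T;
  szero_mul : left_zero szero (@mul T);
  smul_zero : right_zero szero (@mul T) }.

#[short(type="zeroSemigroupType")]
HB.structure Definition ZeroSemigroup := {T of Semigroup_hasZero T & Semigroup T}.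

(* [I(G)] is the term algebra over the generators, a product and a zero, modulo
   the least congruence making it a semigroup with zero in which the defining
   relations hold. *)
Inductive gterm (G : digraph) : Type :=
| TZero
| TVertex of vertex G
| TEdge of edge G
| TInv of edge G
| TMul of gterm G & gterm G.

Arguments TZero {G}.

Inductive gterm_eq (G : digraph) : gterm G -> gterm G -> Prop :=
| gterm_eq_refl x : gterm_eq x x
| gterm_eq_sym x y : gterm_eq x y -> gterm_eq y x
| gterm_eq_trans x y z : gterm_eq x y -> gterm_eq y z -> gterm_eq x z
| gterm_eq_mul x x' y y' :
    gterm_eq x x' -> gterm_eq y y' -> gterm_eq (TMul x y) (TMul x' y')
| gterm_eq_assoc x y z :
    gterm_eq (TMul x (TMul y z)) (TMul (TMul x y) z)
| gterm_eq_zerol x : gterm_eq (TMul TZero x) TZero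
| gterm_eq_zeror x : gterm_eq (TMul x TZero) TZero
| gterm_eq_vv v : gterm_eq (TMul (TVertex v) (TVertex v)) (TVertex v)
| gterm_eq_vu u v :
    u <> v -> gterm_eq (TMul (TVertex u) (TVertex v)) TZero
| gterm_eq_se e : gterm_eq (TMul (TVertex (src e)) (TEdge e)) (TEdge e)
| gterm_eq_er e : gterm_eq (TMul (TEdge e) (TVertex (rng e))) (TEdge e)
| gterm_eq_ri e : gterm_eq (TMul (TVertex (rng e)) (TInv e)) (TInv e)
| gterm_eq_is e : gterm_eq (TMul (TInv e) (TVertex (src e))) (TInv e)
| gterm_eq_ie e : gterm_eq (TMul (TInv e) (TEdge e)) (TVertex (rng e))
| gterm_eq_if e f :
    e <> f -> gterm_eq (TMul (TInv e) (TEdge f)) TZero.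

HB.instance Definition _ (G : digraph) := gen_eqMixin (gterm G).
HB.instance Definition _ (G : digraph) := gen_choiceMixin (gterm G).

Definition gterm_eqb (G : digraph) : rel (gterm G) :=
  fun x y => `[< gterm_eq x y >].

Lemma gterm_eqb_refl G : reflexive (@gterm_eqb G).
Proof. by move=> x; apply/asboolP; constructor. Qed.

Lemma gterm_eqb_sym G : symmetric (@gterm_eqb G).
Proof. by move=> x y; apply/asboolP/asboolP => /gterm_eq_sym. Qed.

Lemma gterm_eqb_trans G : transitive (@gterm_eqb G).
Proof.
by move=> y x z /asboolP xy /asboolP yz; apply/asboolP/(gterm_eq_trans xy yz).
Qed.

Canonical gterm_equiv_rel (G : digraph) :=
  EquivRel (@gterm_eqb G) (@gterm_eqb_refl G) (@gterm_eqb_sym G)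
           (@gterm_eqb_trans G).

Section GraphInverseSemigroup.
Local Open Scope quotient_scope.
Variable G : digraph.

Definition graph_inverse_semigroup : Type := {eq_quot @gterm_eqb G}.
Local Notation I := graph_inverse_semigroup.

HB.instance Definition _ := Choice.on I.
HB.instance Definition _ := EqQuotient.on I.

Lemma gis_piP (x y : gterm G) : \pi_I x = \pi_I y <-> gterm_eq x y.
Proof.
by split=> [/eqmodP/asboolP //|xy]; apply/eqmodP/asboolP.
Qed.

Definition gis_mul (x y : I) : I := \pi_I (TMul (repr x) (repr y)).

Lemma gis_mul_pi (x y : gterm G) :
  gis_mul (\pi_I x) (\pi_I y) = \pi_I (TMul x y).
Proof. by apply/gis_piP/gterm_eq_mul; apply/gis_piP; rewrite reprK. Qed.

Lemma gis_mulA : associative gis_mul.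
Proof.
move=> x y z; rewrite -[x]reprK -[y]reprK -[z]reprK.
move: (repr x) (repr y) (repr z) => {}x {}y {}z.
rewrite (gis_mul_pi y z) (gis_mul_pi x y) (gis_mul_pi x (TMul y z)).
rewrite (gis_mul_pi (TMul x y) z).
exact/gis_piP/gterm_eq_assoc.
Qed.

HB.instance Definition _ := isSemigroup.Build I gis_mulA.

Definition gis_zero : I := \pi_I TZero.

Lemma gis_zero_mul : left_zero gis_zero (@mul I).
Proof.
move=> x; rewrite -[x]reprK [LHS]gis_mul_pi.
exact/gis_piP/gterm_eq_zerol.
Qed.

Lemma gis_mul_zero : right_zero gis_zero (@mul I).
Proof.
move=> x; rewrite -[x]reprK [LHS]gis_mul_pi.
exact/gis_piP/gterm_eq_zeror.
Qed.

HB.instance Definition _ :=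
  Semigroup_hasZero.Build I gis_zero_mul gis_mul_zero.

Definition gis_vertex (v : vertex G) : I := \pi_I (TVertex v).
Definition gis_edge (e : edge G) : I := \pi_I (TEdge e).
Definition gis_inv (e : edge G) : I := \pi_I (TInv e).

Definition composable : rel (edge G) := fun e f => `[< rng e = src f >].

Inductive dpath : Type :=
| EmptyPath of vertex G
| EdgePath (e : edge G) (es : seq (edge G)) of path composable e es.

Definition gis_path (p : dpath) : I :=
  match p with
  | EmptyPath v => gis_vertex v
  | EdgePath e es _ => foldl (fun x f => x * gis_edge f) (gis_edge e) es
  end.

Definition gis_path_inv (p : dpath) : I :=
  match p with
  | EmptyPath v => gis_vertex v
  | EdgePath e es _ => foldl (fun x f => gis_inv f * x) (gis_inv e) es
  end.

Definition Paths : set I := range gis_path.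
Definition PathsInv : set I := range gis_path_inv.

End GraphInverseSemigroup.

Arguments Paths : clear implicits.
Arguments PathsInv : clear implicits.

Section ZeroDivisorGraph.
Variable T : zeroSemigroupType.

(* The natural order and the sets below are the usual ones when [T] is an
   inverse semigroup; their definitions use only the product and the zero. *)
Definition natural_le (a b : T) : Prop := exists e : T, e * e = e /\ a = e * b.

Definition omega (a b : T) : set T :=
  [set c | natural_le c a /\ natural_le c b].

Definition zero_divisors : set T :=
  [set a | a <> szero /\ exists b : T, b <> szero /\ omega a b = [set szero]].

Lemma omegaC (a b : T) : omega a b = omega b a.
Proof. by apply/seteqP; split=> c []. Qed.

End ZeroDivisorGraph.

Record simple_graph (T : Type) := SimpleGraph {
  sg_vertices : set T;
  sg_adj : T -> T -> Prop;
  sg_adj_sym : forall a b, sg_adj a b -> sg_adj b a;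
  sg_adj_irr : forall a, ~ sg_adj a a;
  sg_adj_vertices : forall a b, sg_adj a b -> sg_vertices a }.

Section Graphs.
Variable T : Type.
Implicit Types (H : simple_graph T) (S : set T).

Definition induced_adj H S (a b : T) := [/\ S a, S b & sg_adj H a b].

Lemma induced_adj_sym H S a b : induced_adj H S a b -> induced_adj H S b a.
Proof. by case=> Sa Sb ab; split=> //; exact: sg_adj_sym. Qed.

Lemma induced_adj_irr H S a : ~ induced_adj H S a a.
Proof. by case=> _ _; exact: sg_adj_irr. Qed.

Lemma induced_adj_vertices H S a b :
  induced_adj H S a b -> (sg_vertices H `&` S) a.
Proof. by case=> Sa _ ab; split=> //; exact: sg_adj_vertices ab. Qed.

(* Its vertex set is [S] only when [S] consists of vertices of [H]. *)
Definition induced_subgraph H S : simple_graph T :=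
  SimpleGraph (@induced_adj_sym H S) (@induced_adj_irr H S)
              (@induced_adj_vertices H S).

Definition complete_graph H : Prop :=
  forall a b, sg_vertices H a -> sg_vertices H b -> a <> b -> sg_adj H a b.

End Graphs.

Section ZeroDivisorGraphDef.
Variable T : zeroSemigroupType.

Definition zdg_adj (a b : T) : Prop :=
  [/\ zero_divisors a, zero_divisors b, a <> b & omega a b = [set szero]].

Lemma zdg_adj_sym a b : zdg_adj a b -> zdg_adj b a.
Proof. by case=> Za Zb ab w; split=> //; [exact/nesym | rewrite omegaC]. Qed.

Lemma zdg_adj_irr a : ~ zdg_adj a a.
Proof. by case. Qed.

Lemma zdg_adj_vertices a b : zdg_adj a b -> zero_divisors a.
Proof. by case. Qed.

Definition zero_divisor_graph : simple_graph T :=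
  SimpleGraph zdg_adj_sym zdg_adj_irr zdg_adj_vertices.

End ZeroDivisorGraphDef.

(* Main.v *)
(** [I(G)] acts by partial injections on finite paths, [p q^-1] sending [q t] to
    [p t].  If [c <= a] then [c] acts as a restriction of [a], because an
    idempotent partial injection is a partial identity.  An element of
    [Path(G)] or [Path(G)^-1] prepends or deletes a fixed path, so it is
    determined by its value at any one point; hence a common lower bound of two
    distinct such elements acts as the empty map.  Every element being [0] or of
    the form [p q^-1], only [0] acts as the empty map. *)

Require Import Defs.
From mathcomp Require Import all_boot boolp classical_sets.
Local Open Scope classical_set_scope.

Section PathAction.
Local Open Scope group_scope.
Local Open Scope quotient_scope.
Variable G : digraph.
Local Notation I := (graph_inverse_semigroup G).

(* A path is a list of edges with its final vertex; composability of the edges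
   is deliberately not required, since the relations of [I(G)] hold without it. *)
Definition rawpath : Type := (seq (edge G) * vertex G)%type.
Implicit Types (x y z : rawpath) (l m : seq (edge G)) (v u : vertex G)
  (e f : edge G) (a b c : I) (s t : gterm G).

(** * The action of terms by partial injections *)

Definition start x : vertex G := if x.1 is e :: _ then src e else x.2.

Definition prepend_rel e x y : Prop :=
  y = (e :: x.1, x.2) /\ start x = rng e.

(** Partial maps are encoded as relations, so that [TInv e] is the converse of [TEdge e]. In a
    product the right factor acts first: $p q^{-1}$ deletes $q$, then prepends $p$. *)
Fixpoint term_act t x y : Prop :=
  match t with
  | TZero => False
  | TVertex v => x = y /\ start x = v
  | TEdge e => prepend_rel e x y
  | TInv e => prepend_rel e y x
  | TMul s t => exists2 z, term_act t x z & term_act s z y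
  end.

Lemma term_act_eq s t : gterm_eq s t -> forall x y, term_act s x y <-> term_act t x y.
Proof.
elim=> {s t} /=.
- by [].
- by move=> s t _ IH x y; rewrite IH.
- by move=> s t r _ IH1 _ IH2 x y; rewrite IH1.
- by move=> s s' t t' _ IH1 _ IH2 x y; split=> -[z /IH2 ? /IH1 ?]; exists z.
- move=> s t r x y; split.
    by move=> [z [w ? ?] ?]; exists w => //; exists z.
  by move=> [z ? [w ? ?]]; exists w => //; exists z.
- by move=> t x y; split=> [[]|].
- by move=> t x y; split=> [[]|].
- by move=> v x y; split=> [[z [-> _] []]|[-> ?]] //; exists y.
- by move=> u v uv x y; split=> // -[z [-> xv] [_ xu]]; apply: uv; rewrite -xu.
- move=> e x y; split=> [[z xz [<- _]]|xy] //.
  by exists y => //; split=> //; rewrite xy.1.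
- move=> e x y; split=> [[z [-> _]]|xy] //.
  by exists x => //; split=> //; rewrite xy.2.
- move=> e x y; split=> [[z xz [<- _]]|xy] //.
  by exists y => //; split=> //; rewrite xy.2.
- move=> e x y; split=> [[z [-> _]]|xy] //.
  by exists x => //; split=> //; rewrite xy.1.
- move=> e x y; split=> [[z [-> xe] [[]]]|[-> ye]].
    by case: x xe => l v; case: y => m u /= _ -> -> ?.
  by exists (e :: y.1, y.2).
- by move=> e f ef x y; split=> // -[z [-> _] [[]] /esym].
Qed.

(** Single-valuedness and injectivity are the two directions of one equivalence, which composes
    along products. *)
Lemma term_act_bij t x y x' y' :
  term_act t x y -> term_act t x' y' -> x = x' <-> y = y'.
Proof.
elim: t x y x' y' => [|v|e|e|s IHs t IHt] x y x' y' //=.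
- by move=> [-> _] [-> _].
- case: x x' => [l v] [l' v'] [-> _] [-> _] /=.
  by split=> -[-> ->].
- case: y y' => [l v] [l' v'] [-> _] [-> _] /=.
  by split=> -[-> ->].
- by move=> [z xz zy] [z' xz' zy']; rewrite (IHt _ _ _ _ xz xz'); exact: IHs.
Qed.

Definition act a x y : Prop := term_act (repr a) x y.

Lemma act_pi t x y : act (\pi_I t) x y <-> term_act t x y.
Proof. by apply: term_act_eq; apply/gis_piP; rewrite reprK. Qed.

Lemma act_mul a b x y : act (a * b) x y <-> exists2 z, act b x z & act a z y.
Proof. exact: act_pi. Qed.

Lemma act_zero x y : ~ act szero x y.
Proof. by move=> /act_pi. Qed.

Lemma act_nonzero a x y : act a x y -> a <> szero.
Proof. by move=> axy a0; apply: (@act_zero x y); rewrite -a0. Qed.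

(** Factoring $x \to y$ as $x \to z \to y$, single-valuedness gives $z = y$; then $x$ and $y$ share
    the image $y$, and injectivity gives $x = y$. *)
Lemma act_idempotent a x y : a * a = a -> act a x y -> x = y.
Proof.
move=> aa axy; move: (axy); rewrite -{1}aa => /act_mul[z axz azy].
have zy : z = y by apply/(term_act_bij _ _ _ _ _ axz axy).
by subst z; apply/(term_act_bij _ _ _ _ _ axy azy).
Qed.

Lemma act_natural_le {a b} x y : natural_le a b -> act a x y -> act b x y.
Proof.
by move=> [e [ee ->]] /act_mul[z bxz /(act_idempotent _ _ _ ee) <-].
Qed.

(** * The defining relations in the quotient *)

Lemma vertex_vertex v : gis_vertex v * gis_vertex v = gis_vertex v.
Proof. by rewrite [LHS]gis_mul_pi; apply/gis_piP; constructor. Qed.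

Lemma vertex_neq u v : u <> v -> gis_vertex u * gis_vertex v = szero.
Proof. by move=> ?; rewrite [LHS]gis_mul_pi; apply/gis_piP; constructor. Qed.

Lemma src_edge e : gis_vertex (src e) * gis_edge e = gis_edge e.
Proof. by rewrite [LHS]gis_mul_pi; apply/gis_piP; constructor. Qed.

Lemma edge_rng e : gis_edge e * gis_vertex (rng e) = gis_edge e.
Proof. by rewrite [LHS]gis_mul_pi; apply/gis_piP; constructor. Qed.

Lemma rng_inv e : gis_vertex (rng e) * gis_inv e = gis_inv e.
Proof. by rewrite [LHS]gis_mul_pi; apply/gis_piP; constructor. Qed.

Lemma inv_src e : gis_inv e * gis_vertex (src e) = gis_inv e.
Proof. by rewrite [LHS]gis_mul_pi; apply/gis_piP; constructor. Qed.

Lemma inv_edge e : gis_inv e * gis_edge e = gis_vertex (rng e).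
Proof. by rewrite [LHS]gis_mul_pi; apply/gis_piP; constructor. Qed.

Lemma inv_edge_neq e f : e <> f -> gis_inv e * gis_edge f = szero.
Proof. by move=> ?; rewrite [LHS]gis_mul_pi; apply/gis_piP; constructor. Qed.

(** * Words, their formal inverses, and how they act *)

Fixpoint word l v : I :=
  if l is e :: l' then gis_edge e * word l' v else gis_vertex v.

Fixpoint word_inv l v : I :=
  if l is e :: l' then word_inv l' v * gis_inv e else gis_vertex v.

Lemma start_word l v : gis_vertex (start (l, v)) * word l v = word l v.
Proof. by case: l => [|e l] /=; rewrite ?vertex_vertex // mulgA src_edge. Qed.

Lemma word_inv_start l v : word_inv l v * gis_vertex (start (l, v)) = word_inv l v.
Proof. by case: l => [|e l] /=; rewrite ?vertex_vertex // -mulgA inv_src. Qed.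

(** Inverting reverses the order of the factors and replaces each by its converse; vertices act
    symmetrically. *)
Lemma act_word_inv l v x y : act (word_inv l v) x y <-> act (word l v) y x.
Proof.
elim: l x y => [|e l IH] x y /=.
  by split=> /act_pi[-> ?]; apply/act_pi.
split=> /act_mul[z].
  by move=> /act_pi ? /IH ?; apply/act_mul; exists z => //; exact/act_pi.
by move=> ? /act_pi ?; apply/act_mul; exists z; [exact/act_pi|exact/IH].
Qed.

Lemma act_word l v x y :
  act (word l v) x y -> start x = v /\ y = (l ++ x.1, x.2).
Proof.
elim: l y => [|e l IH] y /=.
  by move=> /act_pi[<- ?]; split=> //; exact: surjective_pairing.
by move=> /act_mul[z /IH[xv ->] /act_pi[-> _]].
Qed.

(** Lists need not be composable. Either all junctions match and the word acts on the empty path at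
    [v], or a mismatch makes it zero. *)
Lemma word_zero_or_act l v : word l v = szero \/ act (word l v) ([::], v) (l, v).
Proof.
elim: l => [|e l [IH|IH]] /=; first by right; apply/act_pi.
  by left; rewrite IH smul_zero.
have [se|se] := pselect (start (l, v) = rng e).
  by right; apply/act_mul; exists (l, v) => //; apply/act_pi.
(* Inserting [rng e] after the edge and the start vertex before the word exposes a product of two
   distinct vertices. *)
left; rewrite -start_word -edge_rng mulgA -(mulgA (gis_edge e)).
by rewrite vertex_neq ?smul_zero ?szero_mul// => /esym.
Qed.

Lemma word_inv_zero_or_act l v :
  word_inv l v = szero \/ act (word_inv l v) (l, v) ([::], v).
Proof.
elim: l => [|e l [IH|IH]] /=; first by right; apply/act_pi.
  by left; rewrite IH szero_mul.
have [se|se] := pselect (start (l, v) = rng e).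
  by right; apply/act_mul; exists (l, v) => //; apply/act_pi.
left; rewrite -word_inv_start -rng_inv mulgA -(mulgA (word_inv l v)).
by rewrite vertex_neq ?smul_zero ?szero_mul.
Qed.

(** Left multiplication by $e^{-1}$ extends the deleted path at its far end, hence [rcons]. *)
Lemma inv_word_inv e l :
  gis_inv e * word_inv l (src e) = word_inv (rcons l e) (rng e).
Proof.
by elim: l => [|f l IH] /=; rewrite ?inv_src ?rng_inv // mulgA IH.
Qed.

(** * Normal forms $p q^{-1}$ *)

Definition normal a : Prop :=
  a = szero \/ exists l m v, a = word l v * word_inv m v.

Lemma normal_vertex_mul u a : normal a -> normal (gis_vertex u * a).
Proof.
case=> [->|[l [m [v ->]]]]; first by left; rewrite smul_zero.
have [->|us] := pselect (u = start (l, v)).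
  by right; exists l, m, v; rewrite mulgA start_word.
left; rewrite mulgA -start_word mulgA vertex_neq //.
by rewrite !szero_mul.
Qed.

Lemma normal_term_mul t a : normal a -> normal (\pi_I t * a).
Proof.
elim: t a => [|u|e|e|s IHs t IHt] a na.
- by left; exact: szero_mul.
- exact: normal_vertex_mul.
- case: na => [->|[l [m [v ->]]]]; first by left; rewrite smul_zero.
  by right; exists (e :: l), m, v; rewrite mulgA.
- case: na => [->|[[|f l] [m [v ->]]]]; first by left; rewrite smul_zero.
    (* With no edge to cancel, $e^{-1}$ meets the vertex [v]: it is absorbed into the inverse word
       if [v] is its source, and otherwise the product vanishes. *)
    have [<-|ev] := pselect (src e = v).
      right; exists [::], (rcons m e), (rng e).
      rewrite /= mulgA -[\pi_I _]/(gis_inv e) inv_src.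
      by rewrite -inv_word_inv mulgA rng_inv.
    left; rewrite mulgA /= -[\pi_I _]/(gis_inv e) -inv_src -(mulgA (gis_inv e)).
    by rewrite vertex_neq // smul_zero szero_mul.
  (* Here $e^{-1} f$ is either zero or the vertex [rng e], which then multiplies a shorter normal
     form. *)
  rewrite /= !mulgA; have [<-|ef] := pselect (e = f).
    rewrite [_ * gis_edge e]inv_edge -mulgA; apply: normal_vertex_mul.
    by right; exists l, m, v.
  by left; rewrite [_ * gis_edge f]inv_edge_neq // !szero_mul.
- have -> : \pi_I (TMul s t) = \pi_I s * \pi_I t by rewrite [RHS]gis_mul_pi.
  by rewrite -mulgA; exact/IHs/IHt.
Qed.

(** For a product, only the right factor has to be normal, since left multiplication by any term
    preserves normality. *)
Lemma normalP a : normal a.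
Proof.
rewrite -[a]reprK; elim: (repr a) => [|v|e|e|s _ t IHt].
- by left.
- by right; exists [::], [::], v; rewrite /= vertex_vertex.
- by right; exists [:: e], [::], (rng e); rewrite /= !edge_rng.
- by right; exists [::], [:: e], (rng e); rewrite /= !rng_inv.
- have -> : \pi_I (TMul s t) = \pi_I s * \pi_I t by rewrite [RHS]gis_mul_pi.
  exact: normal_term_mul.
Qed.

Lemma zero_of_act a : (forall x y, ~ act a x y) -> a = szero.
Proof.
have [//|[l [m [v ->]]] nact] := normalP a.
have [->|ml] := word_inv_zero_or_act m v; first by rewrite smul_zero.
have [->|lm] := word_zero_or_act l v; first by rewrite szero_mul.
(* The inverse word strips [m] down to the empty path at [v], to which the word then prepends
   [l]. *)
by case: (nact (m, v) (l, v)); apply/act_mul; exists ([::], v).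
Qed.

(** * Paths of the graph as words *)

Lemma foldl_edges a e l : a * gis_vertex (rng e) = a ->
  foldl (fun b f => b * gis_edge f) a l = a * word l (rng (last e l)).
Proof.
(* Absorption of [rng e] by [a] supplies the final vertex for the empty list and is inherited by the
   next edge. *)
elim: l a e => [|f l IH] a e ae //=.
by rewrite (IH _ f) ?mulgA // -mulgA edge_rng.
Qed.

Lemma foldl_invs a e l : gis_vertex (rng e) * a = a ->
  foldl (fun b f => gis_inv f * b) a l = word_inv l (rng (last e l)) * a.
Proof.
elim: l a e => [|f l IH] a e ae //=.
by rewrite (IH _ f) ?mulgA // rng_inv.
Qed.

Definition path_edges (p : dpath G) : seq (edge G) :=
  if p is EdgePath e l _ then e :: l else [::].

Definition path_end (p : dpath G) : vertex G :=
  match p with EmptyPath v => v | EdgePath e l _ => rng (last e l) end.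

Lemma gis_pathE p : gis_path p = word (path_edges p) (path_end p).
Proof. by case: p => [v|e l _] //=; apply/foldl_edges/edge_rng. Qed.

Lemma gis_path_invE p : gis_path_inv p = word_inv (path_edges p) (path_end p).
Proof. by case: p => [v|e l _] //=; apply/foldl_invs/rng_inv. Qed.

(** Composability enters here: each edge can be prepended to the tail built so far. Hence no path is
    zero. *)
Lemma act_dpath p :
  act (word (path_edges p) (path_end p)) ([::], path_end p) (path_edges p, path_end p).
Proof.
case: p => [v|e l]; first exact/act_pi.
elim: l e => [|f l IH] e /=.
  by move=> _; apply/act_mul; exists ([::], rng e); exact/act_pi.
move=> /andP[/asboolP ef fl]; apply/act_mul.
exists (f :: l, rng (last f l)); [exact: IH|exact/act_pi].
Qed.

Definition path_elements : set I := Paths G `|` PathsInv G.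

Lemma path_elements_nonzero a : path_elements a -> a <> szero.
Proof.
case=> -[p _ <-].
  rewrite gis_pathE; exact: act_nonzero (act_dpath p).
by rewrite gis_path_invE; apply/act_nonzero/act_word_inv/act_dpath.
Qed.

Lemma vertex_path_elements v : path_elements (gis_vertex v).
Proof. by left; exists (EmptyPath v). Qed.

Lemma edge_path_elements e : path_elements (gis_edge e).
Proof. by left; exists (@EdgePath G e [::] isT). Qed.

(** Neither word shortens a path, so a round trip forces both to have length zero. This is the case
    of a path meeting an inverse path. *)
Lemma act_word_antisym l v m u x y :
  act (word l v) x y -> act (word m u) y x -> [/\ l = [::], m = [::] & v = u].
Proof.
move=> /act_word[<- ->] /act_word[<-] /(congr1 (size \o fst)) /=.
rewrite !size_cat addnA => /eqP.
rewrite -{1}[size x.1]add0n eqn_add2r eq_sym addn_eq0 => /andP[/nilP m0 /nilP l0].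
by rewrite m0 l0; case: x {l0 m0}.
Qed.

Lemma path_elements_act_inj a b x y :
  path_elements a -> path_elements b -> act a x y -> act b x y -> a = b.
Proof.
have word_inj l v m u z w :
    act (word l v) z w -> act (word m u) z w -> l = m /\ v = u.
  (* Two prefixes before the same tail have equal length, hence are equal. *)
  move=> /act_word[<- ->] /act_word[<-] [lm]; split=> //.
  have /eqP := congr1 size lm; rewrite !size_cat eqn_add2r => /eqP sz.
  by rewrite -(take_size_cat z.1 (erefl (size l))) lm take_size_cat.
case=> -[p _ <-] [] [q _ <-]; rewrite ?gis_pathE ?gis_path_invE.
- by move=> ap aq; have [-> ->] := word_inj _ _ _ _ _ _ ap aq.
- by move=> ap /act_word_inv aq; have [-> -> ->] := act_word_antisym _ _ _ _ _ _ ap aq.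
- by move=> /act_word_inv ap aq; have [-> -> ->] := act_word_antisym _ _ _ _ _ _ ap aq.
- move=> /act_word_inv ap /act_word_inv aq.
  by have [-> ->] := word_inj _ _ _ _ _ _ ap aq.
Qed.

Lemma omega_path_elements a b :
  path_elements a -> path_elements b -> a <> b -> omega a b = [set szero].
Proof.
move=> Pa Pb ab; apply/seteqP; split=> [c [ca cb]|_ ->].
  apply: zero_of_act => x y cxy; apply: ab.
  by apply: (path_elements_act_inj a b x y) => //;
    [exact: act_natural_le ca cxy|exact: act_natural_le cb cxy].
by split; exists szero; rewrite !szero_mul.
Qed.

(** * Path elements as zero-divisors *)

Lemma vertex_inj u v : gis_vertex u = gis_vertex v -> u = v.
Proof.
move=> uv; have: act (gis_vertex u) ([::], u) ([::], u) by apply/act_pi.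
by rewrite uv => /act_pi[].
Qed.

Lemma edge_neq_vertex e v : gis_edge e <> gis_vertex v.
Proof.
move=> ev; have: act (gis_edge e) ([::], rng e) ([:: e], rng e) by apply/act_pi.
by rewrite ev => /act_pi[].
Qed.

(** Two distinct path elements suffice, as [a] differs from one of them: an edge and its source, or
    two vertices if there are no edges. *)
Lemma path_elements_other a : nontrivial_digraph G ->
  exists2 b, path_elements b & a <> b.
Proof.
move=> ntG.
suff [b [c [Pb Pc bc]]] : exists b c, [/\ path_elements b, path_elements c & b <> c].
  by have [ab|ab] := pselect (a = b); [exists c; rewrite ?ab|exists b].
have [[e]|noE] := pselect (inhabited (edge G)).
  exists (gis_edge e), (gis_vertex (src e)).
  by split; [exact: edge_path_elements|exact: vertex_path_elements
            |exact: edge_neq_vertex].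
have [v] := vertex_inhabited G.
(* Without edges and without two distinct path elements, every vertex equals [v], so the graph is
   trivial. *)
apply: contra_notP ntG => allS; split; last by move=> e; apply: noE.
exists v => u; apply: contra_notP allS => uv.
exists (gis_vertex u), (gis_vertex v).
by split; [exact: vertex_path_elements|exact: vertex_path_elements
          |move=> /vertex_inj].
Qed.

Lemma path_elements_zero_divisors : nontrivial_digraph G ->
  path_elements `<=` @zero_divisors I.
Proof.
move=> ntG a Pa; split; first exact: path_elements_nonzero.
have [b Pb ab] := path_elements_other a ntG.
by exists b; split; [exact: path_elements_nonzero|exact: omega_path_elements].
Qed.

End PathAction.

Theorem proposition5p3 (G : digraph) (hG : nontrivial_digraph G) :
  (Paths G `|` PathsInv G `<=`
     sg_vertices (zero_divisor_graph (graph_inverse_semigroup G))) /\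
  complete_graph
    (induced_subgraph (zero_divisor_graph (graph_inverse_semigroup G))
                      (Paths G `|` PathsInv G)).
Proof.
split; first exact: path_elements_zero_divisors.
move=> a b [Za Pa] [Zb Pb] ab; split=> //.
by split=> //; exact: omega_path_elements.
Qed.
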